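(* For $t\in(0,1)$ and $n\ge1$, with $H_n(t):=t(t-1)\frac{d}{dt}\ln D_n(t)$, $$H_n(t)=(2n+\alpha+\beta)(y_n-tr_n)-n(n+\alpha)=-(2n+\alpha+\beta)\mathsf p_1(n,t)-n(n+\alpha),$$ and $$r_n(t)=-\frac{H_n'(t)}{2n+\alpha+\beta},\qquad y_n(t)=\frac{-tH_n'(t)+H_n(t)+n(n+\alpha)}{2n+\alpha+\beta}.$$
   Context: Fix $\alpha>0$, $\beta>0$, and real $A,B$ with $A\ge0$, $A+B\ge0$, not both zero; $\theta$ is the Heaviside step function. For $t\in(0,1)$ let $w(x;t)=x^\alpha(1-x)^\beta(A+B\theta(x-t))$ on $[0,1]$, with moments $\mu_i(t)=\int_0^1x^iw\,dx$ and Hankel determinant $D_n(t)=\det(\mu_{j+k}(t))_{j,k=0}^{n-1}$. Let $P_n(x)=P_n(x;t)=x^n+\mathsf p_1(n,t)x^{n-1}+\cdots$ be the monic orthogonal polynomials: $\int_0^1P_iP_jw\,dx=h_i(t)\delta_{ij}$, $h_i>0$. Define $r_n(t)=B\,t^\alpha(1-t)^\beta P_n(t;t)P_{n-1}(t;t)/h_{n-1}$ and $y_n(t)=\frac{\beta}{h_{n-1}}\int_0^1\frac{P_n(y)P_{n-1}(y)}{1-y}\,y^\alpha(1-y)^\beta(A+B\theta(y-t))\,dy$. A prime denotes $d/dt$. *)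

(* Defs.v *)
From Stdlib Require Import Reals Lra ClassicalEpsilon.
Open Scope R_scope.

(* Heaviside step function (value at 0 is irrelevant). *)
Definition theta (x : R) : R := if Rlt_dec x 0 then 0 else 1.

Fixpoint sumR (m : nat) (f : nat -> R) : R :=
  match m with O => 0 | S m' => sumR m' f + f m' end.

(* Integral over (0,1), as an (improper) Riemann integral:
   limit of RiemannInt over [a,b] as a -> 0+, b -> 1-.
   Coincides with the ordinary integral for Riemann-integrable integrands. *)
Definition imp_int01 (f : R -> R) (l : R) : Prop :=
  (forall a b, 0 < a -> a <= b -> b < 1 -> inhabited (Riemann_integrable f a b)) /\
  (forall eps, 0 < eps -> exists del, 0 < del /\
     forall a b (pr : Riemann_integrable f a b),
       0 < a -> a < del -> 1 - del < b -> b < 1 ->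
       Rabs (RiemannInt pr - l) < eps).

Definition Integral01 (f : R -> R) : R := epsilon (inhabits 0) (imp_int01 f).

Definition w (al be A B t x : R) : R :=
  Rpower x al * Rpower (1 - x) be * (A + B * theta (x - t)).

Definition mu (al be A B t : R) (i : nat) : R :=
  Integral01 (fun x => x ^ i * w al be A B t x).

Fixpoint detn (n : nat) (M : nat -> nat -> R) : R :=
  match n with
  | O => 1
  | S m => sum_f_R0 (fun j => (-1) ^ j * M O j *
             detn m (fun i k => M (S i) (if Nat.ltb k j then k else S k))) m
  end.

Definition Dn (al be A B : R) (n : nat) (t : R) : R :=
  detn n (fun j k => mu al be A B t (j + k)).

Definition polyval (n : nat) (c : nat -> R) (x : R) : R :=
  x ^ n + sumR n (fun k => c k * x ^ k).

Definition is_OPS (al be A B t : R) (cf : nat -> nat -> R) : Prop :=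
  (forall i j, i <> j ->
     Integral01 (fun x => polyval i (cf i) x * polyval j (cf j) x * w al be A B t x) = 0) /\
  (forall i, 0 < Integral01 (fun x => polyval i (cf i) x * polyval i (cf i) x * w al be A B t x)).

Definition OPc (al be A B t : R) : nat -> nat -> R :=
  epsilon (inhabits (fun _ _ => 0)) (is_OPS al be A B t).

Definition P (al be A B : R) (n : nat) (t x : R) : R := polyval n (OPc al be A B t n) x.

Definition h (al be A B : R) (i : nat) (t : R) : R :=
  Integral01 (fun x => P al be A B i t x * P al be A B i t x * w al be A B t x).

(* p_1(n,t): coefficient of x^(n-1) in P_n (for n >= 1) *)
Definition p1 (al be A B : R) (n : nat) (t : R) : R := OPc al be A B t n (Nat.pred n).

Definition r (al be A B : R) (n : nat) (t : R) : R :=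
  B * Rpower t al * Rpower (1 - t) be * P al be A B n t t * P al be A B (n - 1) t t
    / h al be A B (n - 1) t.

Definition y (al be A B : R) (n : nat) (t : R) : R :=
  be / h al be A B (n - 1) t *
  Integral01 (fun u => P al be A B n t u * P al be A B (n - 1) t u / (1 - u)
                        * w al be A B t u).

Definition Hn (al be A B : R) (n : nat) (t : R) : R :=
  t * (t - 1) * epsilon (inhabits 0)
    (fun l => derivable_pt_lim (fun s => ln (Dn al be A B n s)) t l).

(* Main.v *)
Require Import Defs.
From Stdlib Require Import Reals Lra Lia ClassicalEpsilon.
From mathcomp Require all_boot all_algebra Rstruct.
From Coquelicot Require Import Coquelicot.
Open Scope R_scope.

(** Write [W x = x^al (1-x)^be] and [<f> = A int_0^1 f W + B int_t^1 f W], so that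
    [d/dt <f> = - B f(t) W(t)] for fixed [f].  Gram-Schmidt shows that the coefficients of
    [P_n] are differentiable in [t], and [D_n = h_0 ... h_(n-1)].  Differentiating
    [h_k = <P_k^2>] and [0 = <P_n P_(n-1)>], where [dP_n/dt] has degree [< n], gives
    [h_k' = - B W(t) P_k(t)^2] and [p_1(n)' = r_n]; hence
    [H_n = t (1-t) B W(t) sum_(k<n) P_k(t)^2 / h_k].
    Integrating the derivative of [x (1-x) W P_k^2] expresses the [k]-th summand through
    [p_1(k)] and [p_1(k+1)], and the sum telescopes to
    [- (2n+al+be) p_1(n) - n (n+al)].  Integrating the derivative of [x W P_n P_(n-1)],
    without the factor [1-x], produces the integral in [y_n] and gives
    [y_n - t r_n = - p_1(n)]. *)

(** [Integral01], [OPc] and the derivative inside [Hn] are [epsilon] choices: each is meaningful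
    only once some value with the required property has been produced, and is computed only through
    uniqueness. [OPc] is chosen separately at every [t], so nothing makes it regular in [t], and its
    entries with index at least the degree stay arbitrary. Regularity is therefore proved for a
    Gram-Schmidt family and carried over to the lower entries by uniqueness of orthogonal
    polynomials. The weight factor [W] is extended by 0 to a continuous function on the whole line;
    it vanishes at 0 and 1, so every boundary term in an integration by parts sits at [t]. Only the
    integral in [y] may have an unbounded integrand. No theorem on differentiation under the
    integral sign is required: integrands depend on the parameter through polynomials of bounded
    degree, so their integrals are finite sums of coefficients times moments, and [t] enters a
    moment only as a limit of integration. *)

Fixpoint prodR (m : nat) (f : nat -> R) : R :=
  match m with O => 1 | S m' => prodR m' f * f m' end.

(** * Determinant of a Gram matrix *)

Module Determinant.
Import all_boot all_algebra Rstruct.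
Import GRing.Theory.
Local Open Scope ring_scope.

Lemma sumR_big m (f : nat -> R) : sumR m f = \sum_(i < m) f i.
Proof. by elim: m => [|m IH] /=; rewrite ?big_ord0 // big_ord_recr -IH. Qed.

Lemma prodR_big m (f : nat -> R) : prodR m f = \prod_(i < m) f i.
Proof. by elim: m => [|m IH] /=; rewrite ?big_ord0 // big_ord_recr -IH. Qed.

Lemma sum_f_R0_big m (f : nat -> R) : sum_f_R0 f m = \sum_(i < m.+1) f i.
Proof.
elim: m => [|m IH] /=; first by rewrite big_ord_recl big_ord0 addr0.
by rewrite big_ord_recr -IH.
Qed.

(** [detn] is the cofactor expansion along row 0, and its conditional column index is [bump], so the
    two expansions agree term by term. *)
Lemma detn_det n (M : nat -> nat -> R) :
  detn n M = \det (\matrix_(i < n, j < n) M i j).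
Proof.
elim: n M => [|n IH] M /=; first by rewrite det_mx00.
rewrite sum_f_R0_big (expand_det_row _ ord0); apply: eq_bigr => j _.
rewrite /cofactor IH mxE RpowE add0n mulrCA mulrA.
congr (_ * \det _); apply/matrixP => i k; rewrite !mxE.
congr (M _ _); rewrite /= /bump.
have -> : Nat.ltb k j = (k < j)%N.
  by apply/idP/idP => [/PeanoNat.Nat.ltb_lt/ssrnat.ltP|/ssrnat.ltP/PeanoNat.Nat.ltb_lt].
by case: ltnP.
Qed.

Local Open Scope R_scope.

(** [C] is unit lower triangular, so [C G C^T] has the same determinant as [G], and the third
    hypothesis says that this product is diagonal. *)
Lemma detn_gram n (G C : nat -> nat -> R) (d : nat -> R) :
  (forall i, C i i = 1) -> (forall i j, lt i j -> C i j = 0) ->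
  (forall i j, lt i n -> lt j n ->
     sumR n (fun k => sumR n (fun l => C i k * C j l * G k l)) =
     if Nat.eqb i j then d i else 0) ->
  detn n G = prodR n d.
Proof.
move=> C1 C0 CG; rewrite detn_det prodR_big.
pose Gm : 'M[R]_n := \matrix_(i, j) G i j; pose Cm : 'M[R]_n := \matrix_(i, j) C i j.
have Ctrig : is_trig_mx Cm.
  by apply/is_trig_mxP => i j ij; rewrite mxE; apply/C0/ssrnat.ltP.
have Cdet : \det Cm = 1%R.
  by rewrite det_trig // big1 // => i _; rewrite mxE C1.
have CGC : (Cm *m Gm *m Cm^T)%R = diag_mx (\row_i d i)%R.
  apply/matrixP => i j; rewrite !mxE.
  transitivity (sumR n (fun k => sumR n (fun l => C i k * C j l * G k l))).
    rewrite sumR_big.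
    under eq_bigr => l _ do rewrite !mxE big_distrl /=.
    rewrite exchange_big /=; apply: eq_bigr => k _.
    rewrite sumR_big; apply: eq_bigr => l _.
    by rewrite !mxE mulrAC.
  rewrite CG; try exact/ssrnat.ltP.
  have -> : Nat.eqb i j = (i == j).
    by apply/idP/idP => [/PeanoNat.Nat.eqb_eq/ord_inj/eqP|/eqP->]; rewrite ?PeanoNat.Nat.eqb_refl.
  by case: eqP => [->|_]; rewrite ?mulr1n ?mulr0n.
have := congr1 determinant CGC.
rewrite !det_mulmx det_tr Cdet det_diag mul1r mulr1 => ->.
by apply: eq_bigr => i _; rewrite mxE.
Qed.
End Determinant.

(** * Finite sums and rules for derivatives *)

Lemma sumR_ext n f g : (forall k, (k < n)%nat -> f k = g k) -> sumR n f = sumR n g.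
Proof.
  induction n as [|n IH]; intros H; simpl; [reflexivity|].
  rewrite IH, H; auto.
Qed.

Lemma sumR_plus n f g : sumR n (fun k => f k + g k) = sumR n f + sumR n g.
Proof. induction n as [|n IH]; simpl; [|rewrite IH]; ring. Qed.

Lemma sumR_scal n a f : sumR n (fun k => a * f k) = a * sumR n f.
Proof. induction n as [|n IH]; simpl; [|rewrite IH]; ring. Qed.

Lemma sumR_zero n : sumR n (fun _ => 0) = 0.
Proof. induction n as [|n IH]; simpl; [|rewrite IH]; ring. Qed.

Lemma sumR_swap n m f :
  sumR n (fun i => sumR m (fun j => f i j)) = sumR m (fun j => sumR n (fun i => f i j)).
Proof.
  induction n as [|n IH]; simpl.
  - now rewrite sumR_zero.
  - rewrite IH, <- sumR_plus. now apply sumR_ext.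
Qed.

Lemma sumR_pad n m f : (n <= m)%nat ->
  sumR m (fun k => if Nat.ltb k n then f k else 0) = sumR n f.
Proof.
  intros H. induction m as [|m IH]; simpl.
  - replace n with 0%nat by lia. reflexivity.
  - destruct (Nat.eq_dec n (S m)) as [->|Hn].
    + simpl. f_equal.
      * apply sumR_ext. intros k Hk. now rewrite (proj2 (Nat.ltb_lt k (S m))) by lia.
      * now rewrite (proj2 (Nat.ltb_lt m (S m))) by lia.
    + rewrite IH by lia. rewrite (proj2 (Nat.ltb_ge m n)) by lia. ring.
Qed.

Lemma sumR_single n j f : (j < n)%nat ->
  (forall k, (k < n)%nat -> k <> j -> f k = 0) -> sumR n f = f j.
Proof.
  induction n as [|n IH]; intros Hj H; [lia|simpl].
  destruct (Nat.eq_dec j n) as [->|Hn].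
  - rewrite (sumR_ext n f (fun _ => 0)), sumR_zero; [ring|].
    intros k Hk; apply H; lia.
  - rewrite IH, (H n); try lia; [ring|]. intros; apply H; lia.
Qed.

Lemma is_derive_sumR n (f : nat -> R -> R) d x :
  (forall k, (k < n)%nat -> is_derive (f k) x (d k)) ->
  is_derive (fun z => sumR n (fun k => f k z)) x (sumR n d).
Proof.
  induction n as [|n IH]; intros H; simpl.
  - apply @is_derive_const.
  - apply @is_derive_plus; auto.
Qed.

Lemma is_derive_Rmult (f g : R -> R) (x df dg : R) :
  is_derive f x df -> is_derive g x dg ->
  is_derive (fun z => f z * g z) x (df * g x + f x * dg).
Proof. intros Hf Hg. apply @is_derive_mult; auto. intros; apply Rmult_comm. Qed.

Lemma is_derive_Rplus (f g : R -> R) (x df dg : R) :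
  is_derive f x df -> is_derive g x dg ->
  is_derive (fun z => f z + g z) x (df + dg).
Proof. intros Hf Hg. now apply @is_derive_plus. Qed.

Lemma is_derive_Rconst (a x : R) : is_derive (fun _ => a) x 0.
Proof. apply @is_derive_const. Qed.

Lemma is_derive_eq (f : R -> R) (x l l' : R) : is_derive f x l -> l = l' -> is_derive f x l'.
Proof. now intros H <-. Qed.

Lemma is_derive_uniq (f : R -> R) (x l l' : R) : is_derive f x l -> is_derive f x l' -> l = l'.
Proof.
  intros H H'. apply is_derive_unique in H. apply is_derive_unique in H'. congruence.
Qed.

Lemma locally_open_interval (a b x : R) : a < x < b -> locally x (fun z => a < z < b).
Proof.
  intros [Ha Hb].
  assert (He : 0 < Rmin (x - a) (b - x)) by (apply Rmin_case; lra).
  exists (mkposreal _ He). intros z Hz.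
  assert (Rabs (z - x) < Rmin (x - a) (b - x)) as H by exact Hz.
  pose proof (Rmin_l (x - a) (b - x)). pose proof (Rmin_r (x - a) (b - x)).
  apply Rabs_def2 in H. lra.
Qed.

(** * Polynomial functions *)

Definition pv (N : nat) (c : nat -> R) (x : R) : R := sumR N (fun k => c k * x ^ k).

Definition deg_lt (N : nat) (f : R -> R) : Prop := exists c, forall x, f x = pv N c x.

Definition dpv (N : nat) (c : nat -> R) (x : R) : R :=
  sumR N (fun k => c k * (INR k * x ^ Nat.pred k)).

Lemma pv_plus N c d x : pv N (fun k => c k + d k) x = pv N c x + pv N d x.
Proof.
  unfold pv. rewrite <- sumR_plus. apply sumR_ext. intros; ring.
Qed.

Lemma pv_scal N a c x : pv N (fun k => a * c k) x = a * pv N c x.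
Proof.
  unfold pv. rewrite <- sumR_scal. apply sumR_ext. intros; ring.
Qed.

Lemma pv_pad N M c x : (N <= M)%nat ->
  pv M (fun k => if Nat.ltb k N then c k else 0) x = pv N c x.
Proof.
  intros H. unfold pv. rewrite <- (sumR_pad N M) by assumption.
  apply sumR_ext. intros k _. destruct (Nat.ltb k N); ring.
Qed.

Lemma pv_shift N c x :
  pv (S N) (fun k => match k with O => 0 | S k => c k end) x = x * pv N c x.
Proof.
  unfold pv. induction N as [|N IH].
  - simpl. ring.
  - change (sumR (S (S N)) ?f) with (sumR (S N) f + f (S N)).
    rewrite IH. simpl. ring.
Qed.

Lemma is_derive_pv N c x : is_derive (pv N c) x (dpv N c x).
Proof.
  apply (is_derive_sumR N (fun k x => c k * x ^ k)).
  intros k _. apply @is_derive_scal.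
  eapply is_derive_eq; [apply (is_derive_pow (fun x => x)), @is_derive_id|].
  unfold one; simpl. ring.
Qed.

Lemma mul_dpv N c x : x * dpv N c x = pv N (fun k => INR k * c k) x.
Proof.
  unfold dpv, pv. rewrite <- sumR_scal. apply sumR_ext. intros [|k] _; simpl; ring.
Qed.

Lemma deg_lt_pv N c : deg_lt N (pv N c).
Proof. now exists c. Qed.

Lemma deg_lt_ext N f g : (forall x, f x = g x) -> deg_lt N f -> deg_lt N g.
Proof. intros H [c Hc]. exists c. intros x. now rewrite <- H. Qed.

Lemma deg_lt_le N M f : (N <= M)%nat -> deg_lt N f -> deg_lt M f.
Proof.
  intros H [c Hc]. eexists. intros x. now rewrite Hc, <- (pv_pad N M c x H).
Qed.

Lemma deg_lt_plus N f g : deg_lt N f -> deg_lt N g -> deg_lt N (fun x => f x + g x).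
Proof.
  intros [c Hc] [d Hd]. eexists. intros x. now rewrite Hc, Hd, <- pv_plus.
Qed.

Lemma deg_lt_scal N a f : deg_lt N f -> deg_lt N (fun x => a * f x).
Proof. intros [c Hc]. eexists. intros x. now rewrite Hc, <- pv_scal. Qed.

Lemma deg_lt_mulX N f : deg_lt N f -> deg_lt (S N) (fun x => x * f x).
Proof. intros [c Hc]. eexists. intros x. now rewrite Hc, <- pv_shift. Qed.

Lemma deg_lt_zero N : deg_lt N (fun _ => 0).
Proof.
  exists (fun _ => 0). intros x. unfold pv.
  rewrite (sumR_ext N _ (fun _ => 0)), sumR_zero; [reflexivity|]. intros; ring.
Qed.

Lemma deg_lt_pow n N : (n < N)%nat -> deg_lt N (fun x => x ^ n).
Proof.
  intros H. apply (deg_lt_le (S n)); [lia|]. clear N H.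
  induction n as [|n IH].
  - exists (fun _ => 1). intros x. unfold pv; simpl; ring.
  - apply (deg_lt_mulX _ _ IH).
Qed.

Lemma deg_lt_S N f : deg_lt (S N) f ->
  exists a g, deg_lt N g /\ forall x, f x = a * x ^ N + g x.
Proof.
  intros [c Hc]. exists (c N), (pv N c). split; [apply deg_lt_pv|].
  intros x. rewrite Hc. unfold pv; simpl. ring.
Qed.

Lemma deg_lt_polyval n c : deg_lt (S n) (polyval n c).
Proof.
  apply (deg_lt_ext (S n) (fun x => x ^ n + pv n c x)); [reflexivity|].
  apply deg_lt_plus; [apply deg_lt_pow; lia|].
  apply (deg_lt_le n); [lia|apply deg_lt_pv].
Qed.

Lemma deg_lt_derive N f : deg_lt (S N) f ->
  exists f', deg_lt N f' /\ forall x, is_derive f x (f' x).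
Proof.
  intros [c Hc]. exists (dpv (S N) c). split.
  - exists (fun k => INR (S k) * c (S k)). intros x. unfold dpv, pv. clear f Hc.
    induction N as [|N IH]; [simpl; ring|].
    change (sumR (S (S N)) ?f) with (sumR (S N) f + f (S N)). rewrite IH.
    cbn [sumR Nat.pred]. ring.
  - intros x. apply (is_derive_ext (pv (S N) c)); [now intros; rewrite Hc|].
    apply is_derive_pv.
Qed.

(** Differentiating the identity on the open interval lowers the degree and turns the leading
    coefficient [a] into [a * INR (S n)], which is what the induction needs. *)
Lemma leading_coef_zero n : forall a g u v,
  u < v -> deg_lt n g -> (forall x, u < x < v -> a * x ^ n + g x = 0) -> a = 0.
Proof.
  induction n as [|n IH]; intros a g u v Huv Hg H.
  - destruct Hg as [c Hc]. specialize (H ((u + v) / 2)). rewrite Hc in H.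
    unfold pv in H; simpl in H. lra.
  - destruct (deg_lt_derive _ _ Hg) as [g' [Hg' Dg]].
    enough (a * INR (S n) = 0) as E.
    { apply Rmult_integral in E. destruct E as [E|E]; [assumption|].
      exfalso. now apply (not_0_INR (S n)). }
    apply (IH _ g' u v Huv Hg'). intros x Hx.
    apply (is_derive_uniq (fun x => a * x ^ S n + g x) x).
    + eapply is_derive_eq.
      * apply is_derive_Rplus; [|apply Dg]. apply @is_derive_scal.
        apply (is_derive_pow (fun x => x)), @is_derive_id.
      * unfold one; simpl. destruct n; simpl; ring.
    + apply (is_derive_ext_loc (fun _ => 0)); [|apply is_derive_Rconst].
      apply (filter_imp (fun z => u < z < v)); [|now apply locally_open_interval].
      intros z Hz. now rewrite H.
Qed.

Lemma pv_zero_coef N c u v : u < v -> (forall x, u < x < v -> pv N c x = 0) ->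
  forall k, (k < N)%nat -> c k = 0.
Proof.
  intros Huv. induction N as [|N IH]; intros H k Hk; [lia|].
  assert (E : c N = 0).
  { apply (leading_coef_zero N _ (pv N c) u v Huv (deg_lt_pv N c)).
    intros x Hx. rewrite <- (H x Hx). unfold pv; simpl. ring. }
  destruct (Nat.eq_dec k N) as [->|Hn]; [assumption|].
  apply IH; [|lia]. intros x Hx. specialize (H x Hx). unfold pv in *; simpl in H.
  rewrite E in H. lra.
Qed.

(** * Continuity on the whole line *)

Definition cont (f : R -> R) : Prop := forall x, continuous f x.

Lemma cont_ext f g : (forall x, f x = g x) -> cont f -> cont g.
Proof. intros H Hf x. now apply (continuous_ext f). Qed.

Lemma cont_plus f g : cont f -> cont g -> cont (fun x => f x + g x).
Proof. intros Hf Hg x. now apply @continuous_plus. Qed.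

Lemma cont_minus f g : cont f -> cont g -> cont (fun x => f x - g x).
Proof. intros Hf Hg x. now apply @continuous_minus. Qed.

Lemma cont_mult f g : cont f -> cont g -> cont (fun x => f x * g x).
Proof. intros Hf Hg x. now apply @continuous_mult. Qed.

Lemma cont_const a : cont (fun _ => a).
Proof. intros x. apply continuous_const. Qed.

Lemma cont_id : cont (fun x => x).
Proof. intros x. apply continuous_id. Qed.

Lemma cont_comp f g : cont f -> cont g -> cont (fun x => f (g x)).
Proof. intros Hf Hg x. now apply continuous_comp. Qed.

Lemma cont_pow n : cont (fun x => x ^ n).
Proof.
  induction n as [|n IH]; simpl; [apply cont_const|]. apply cont_mult; [apply cont_id|exact IH].
Qed.

Lemma cont_deg_lt N f : deg_lt N f -> cont f.
Proof.
  intros [c Hc]. apply (cont_ext (pv N c)); [now intros; rewrite Hc|].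
  intros x. apply @ex_derive_continuous. eexists. apply is_derive_pv.
Qed.

Lemma cont_pv N c : cont (pv N c).
Proof. apply (cont_deg_lt N), deg_lt_pv. Qed.

Lemma cont_dpv N c : cont (dpv N c).
Proof.
  unfold dpv. induction N as [|N IH]; simpl; [apply cont_const|].
  apply cont_plus; [exact IH|]. apply cont_mult; [apply cont_const|].
  apply cont_mult; [apply cont_const|apply cont_pow].
Qed.

Lemma cont_polyval n c : cont (polyval n c).
Proof. apply (cont_deg_lt (S n)), deg_lt_polyval. Qed.

Ltac solve_cont := repeat (cbv beta; lazymatch goal with
  | |- cont (fun x => @?f x + @?g x) => apply (cont_plus f g)
  | |- cont (fun x => @?f x - @?g x) => apply (cont_minus f g)
  | |- cont (fun x => @?f x * @?g x) => apply (cont_mult f g)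
  | |- cont (fun _ => ?a) => exact (cont_const a)
  | |- cont (fun x => x) => exact cont_id
  | |- cont (fun x => x ^ ?n) => exact (cont_pow n)
  | |- cont (pv ?N ?c) => exact (cont_pv N c)
  | |- cont (fun x => pv ?N ?c x) => exact (cont_pv N c)
  | |- cont (dpv ?N ?c) => exact (cont_dpv N c)
  | |- cont (fun x => dpv ?N ?c x) => exact (cont_dpv N c)
  | |- cont (polyval ?N ?c) => exact (cont_polyval N c)
  | |- cont (fun x => polyval ?N ?c x) => exact (cont_polyval N c)
  | |- cont _ => eassumption
  end).

(** * Integrals against the weight *)

Lemma ex_RInt_cont f a b : cont f -> ex_RInt f a b.
Proof. intros Hf. apply @ex_RInt_continuous. intros; apply Hf. Qed.

Lemma is_derive_RInt_upper f a x : cont f -> is_derive (fun z => RInt f a z) x (f x).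
Proof.
  intros Hf. apply @is_derive_RInt with (a := a); [|apply Hf].
  apply filter_forall. intros z. apply @RInt_correct, ex_RInt_cont, Hf.
Qed.

Lemma is_derive_RInt_lower f b x : cont f -> is_derive (fun z => RInt f z b) x (- f x).
Proof.
  intros Hf. apply @is_derive_RInt' with (b := b); [|apply Hf].
  apply filter_forall. intros z. apply @RInt_correct, ex_RInt_cont, Hf.
Qed.

(** If the integral were 0, nonnegativity would force the primitive from [a] to be 0 throughout the
    interval, and its derivative at [x], which is [f x], would vanish. *)
Lemma RInt_pos f a b x : cont f -> (forall z, a <= z <= b -> 0 <= f z) ->
  a < x < b -> 0 < f x -> 0 < RInt f a b.
Proof.
  intros Hf Hp Hx Hfx.
  assert (Hge : forall u v, a <= u -> u <= v -> v <= b -> 0 <= RInt f u v).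
  { intros u v Hu Huv Hv. apply RInt_ge_0; [assumption|now apply ex_RInt_cont|].
    intros z Hz. apply Hp. lra. }
  destruct (Hge a b) as [H|H]; try lra.
  exfalso. assert (f x = 0); [|lra].
  apply (is_derive_uniq (fun z => RInt f a z) x); [now apply is_derive_RInt_upper|].
  apply (is_derive_ext_loc (fun _ => 0)); [|apply is_derive_Rconst].
  apply (filter_imp (fun z => a < z < b)); [|now apply locally_open_interval].
  intros z Hz.
  pose proof (RInt_Chasles f a z b (ex_RInt_cont _ _ _ Hf) (ex_RInt_cont _ _ _ Hf)) as E.
  unfold plus in E; simpl in E.
  pose proof (Hge a z). pose proof (Hge z b). lra.
Qed.

(** * The improper integral over (0,1) *)

Lemma imp_int01_unique f l l' : imp_int01 f l -> imp_int01 f l' -> l = l'.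
Proof.
  intros [Hi H] [_ H']. destruct (Req_dec l l') as [|Hn]; [assumption|exfalso].
  assert (He : 0 < Rabs (l - l') / 2) by (apply Rdiv_lt_0_compat; [apply Rabs_pos_lt|]; lra).
  destruct (H _ He) as [d [Hd Hl]]. destruct (H' _ He) as [d' [Hd' Hl']].
  set (m := Rmin (Rmin d d') 1 / 2).
  assert (Hm : 0 < m /\ m < d /\ m < d' /\ m <= 1 / 2).
  { unfold m. pose proof (Rmin_l (Rmin d d') 1). pose proof (Rmin_r (Rmin d d') 1).
    pose proof (Rmin_l d d'). pose proof (Rmin_r d d').
    assert (0 < Rmin (Rmin d d') 1) by (repeat apply Rmin_case; lra). lra. }
  destruct (Hi m (1 - m)) as [pr]; try lra.
  specialize (Hl m (1 - m) pr). specialize (Hl' m (1 - m) pr).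
  assert (Rabs (l - l') <= Rabs (RiemannInt pr - l) + Rabs (RiemannInt pr - l')).
  { rewrite (Rabs_minus_sym (RiemannInt pr) l).
    eapply Rle_trans; [|apply Rabs_triang]. right. f_equal. ring. }
  lra.
Qed.

Lemma Integral01_eq f l : imp_int01 f l -> Integral01 f = l.
Proof.
  intros H. apply (imp_int01_unique f); [|assumption].
  unfold Integral01. apply epsilon_spec. now exists l.
Qed.

(** Continuity of [G] at 0 and 1 turns the formula on inner intervals into the limit, so convergence
    and value come together even if [f] is unbounded. *)
Lemma imp_int01_antideriv (f G : R -> R) : continuous G 0 -> continuous G 1 ->
  (forall a b, 0 < a -> a <= b -> b < 1 -> is_RInt f a b (G b - G a)) ->
  imp_int01 f (G 1 - G 0).
Proof.
  intros H0 H1 H. split.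
  - intros a b Ha Hab Hb. constructor. apply ex_RInt_Reals_0. eexists. now apply H.
  - intros eps He. assert (He2 : 0 < eps / 2) by lra.
    destruct (H0 _ (locally_ball (G 0) (mkposreal _ He2))) as [d0 D0].
    destruct (H1 _ (locally_ball (G 1) (mkposreal _ He2))) as [d1 D1].
    (* The cap 1/2 forces [a < 1/2 < b], as the formula for inner intervals is assumed only for
       [a <= b]. *)
    exists (Rmin (Rmin d0 d1) (1 / 2)).
    pose proof (Rmin_l (Rmin d0 d1) (1 / 2)). pose proof (Rmin_r (Rmin d0 d1) (1 / 2)).
    pose proof (Rmin_l d0 d1). pose proof (Rmin_r d0 d1).
    pose proof (cond_pos d0). pose proof (cond_pos d1).
    split; [repeat apply Rmin_case; lra|].
    intros a b pr Ha Hda Hdb Hb.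
    rewrite <- RInt_Reals. rewrite (is_RInt_unique _ _ _ _ (H a b Ha ltac:(lra) Hb)).
    assert (E0 : Rabs (G a - G 0) < eps / 2).
    { apply D0. change (Rabs (a - 0) < d0). rewrite Rabs_right; lra. }
    assert (E1 : Rabs (G b - G 1) < eps / 2).
    { apply D1. change (Rabs (b - 1) < d1). rewrite Rabs_left; lra. }
    apply Rabs_def2 in E0. apply Rabs_def2 in E1. apply Rabs_def1; lra.
Qed.

Lemma imp_int01_step (phi K : R -> R) (A B t : R) : 0 < t < 1 -> continuous K 0 -> continuous K 1 ->
  (forall x, 0 < x < 1 -> is_derive K x (phi x)) ->
  (forall x, 0 < x < 1 -> continuous phi x) ->
  imp_int01 (fun x => phi x * (A + B * theta (x - t))) (A * (K 1 - K 0) + B * (K 1 - K t)).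
Proof.
  intros Ht K0 K1 DK Cphi.
  (* [Rmax x t] freezes the second term to the left of [t], so [G] is a primitive on each side of
     the jump and stays continuous across it. *)
  set (G := fun x => A * K x + B * K (Rmax x t)).
  replace (A * (K 1 - K 0) + B * (K 1 - K t)) with (G 1 - G 0)
    by (unfold G; rewrite (Rmax_left 1 t), (Rmax_right 0 t) by lra; ring).
  assert (Hphi : forall a b, 0 < a -> a <= b -> b < 1 -> is_RInt phi a b (K b - K a)).
  { intros a b Ha Hab Hb. apply (is_RInt_derive K phi a b);
      intros x; rewrite Rmin_left, Rmax_right by lra; intros Hx; [apply DK|apply Cphi]; lra. }
  assert (Hlo : forall a b, 0 < a -> a <= b -> b <= t ->
    is_RInt (fun x => phi x * (A + B * theta (x - t))) a b (G b - G a)).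
  { intros a b Ha Hab Hb. replace (G b - G a) with (scal A (K b - K a)).
    - apply (is_RInt_ext (fun x => scal A (phi x))).
      + rewrite Rmin_left, Rmax_right by lra. intros x Hx.
        change (A * phi x = phi x * (A + B * theta (x - t))). unfold theta.
        destruct (Rlt_dec (x - t) 0); [ring|lra].
      + apply @is_RInt_scal, Hphi; lra.
    - unfold G, scal; simpl; unfold mult; simpl. rewrite !Rmax_right by lra. ring. }
  assert (Hhi : forall a b, t <= a -> a <= b -> b < 1 ->
    is_RInt (fun x => phi x * (A + B * theta (x - t))) a b (G b - G a)).
  { intros a b Ha Hab Hb. replace (G b - G a) with (scal (A + B) (K b - K a)).
    - apply (is_RInt_ext (fun x => scal (A + B) (phi x))).
      + rewrite Rmin_left, Rmax_right by lra. intros x Hx.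
        change ((A + B) * phi x = phi x * (A + B * theta (x - t))). unfold theta.
        destruct (Rlt_dec (x - t) 0); [lra|ring].
      + apply @is_RInt_scal, Hphi; lra.
    - unfold G, scal; simpl; unfold mult; simpl. rewrite !Rmax_left by lra. ring. }
  apply imp_int01_antideriv.
  - apply (continuous_ext_loc _ (fun x => A * K x + B * K t)).
    + apply (filter_imp (fun z => -1 < z < t)); [|apply locally_open_interval; lra].
      intros z Hz. unfold G. now rewrite Rmax_right by lra.
    + apply (continuous_plus (fun x => A * K x) (fun _ => B * K t)).
      * apply (continuous_scal_r A K). assumption.
      * apply continuous_const.
  - apply (continuous_ext_loc _ (fun x => (A + B) * K x)).
    + apply (filter_imp (fun z => t < z < 2)); [|apply locally_open_interval; lra].
      intros z Hz. unfold G. rewrite Rmax_left by lra.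
      change ((A + B) * K z = A * K z + B * K z). ring.
    + apply (continuous_scal_r (A + B) K). assumption.
  - intros a b Ha Hab Hb. destruct (Rle_lt_dec b t); [apply Hlo; lra|].
    destruct (Rle_lt_dec t a); [apply Hhi; lra|].
    replace (G b - G a) with ((G t - G a) + (G b - G t)) by ring.
    apply (is_RInt_Chasles (V := R_NormedModule) _ a t b (G t - G a) (G b - G t));
      [apply Hlo|apply Hhi]; lra.
Qed.

Lemma imp_int01_ext f g l : (forall x, 0 < x < 1 -> f x = g x) ->
  imp_int01 f l -> imp_int01 g l.
Proof.
  intros E [Hi H].
  assert (Ei : forall a b, 0 < a -> a <= b -> b < 1 ->
    forall x, Rmin a b < x < Rmax a b -> f x = g x).
  { intros a b Ha Hab Hb x. rewrite Rmin_left, Rmax_right by lra. intros; apply E; lra. }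
  split.
  - intros a b Ha Hab Hb. destruct (Hi a b Ha Hab Hb) as [pr]. constructor.
    apply ex_RInt_Reals_0, (ex_RInt_ext f); [now apply Ei|]. now apply ex_RInt_Reals_1.
  - intros eps He. destruct (H eps He) as [d [Hd Hl]].
    exists (Rmin d (1 / 2)). pose proof (Rmin_l d (1 / 2)). pose proof (Rmin_r d (1 / 2)).
    split; [apply Rmin_case; lra|].
    intros a b pr Ha Hda Hdb Hb. destruct (Hi a b) as [pr']; try lra.
    rewrite <- RInt_Reals, <- (RInt_ext f g a b), (RInt_Reals f a b pr').
    + apply Hl; lra.
    + apply Ei; lra.
Qed.

(* [Rpower 0 a] is [1] in Stdlib; this is the continuous extension by [0]. *)
Definition pw (a x : R) : R := if Rlt_dec 0 x then Rpower x a else 0.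

Lemma cont_pw a : 0 < a -> cont (pw a).
Proof.
  intros Ha x. destruct (Rtotal_order x 0) as [Hx|[->|Hx]].
  - apply (continuous_ext_loc _ (fun _ => 0)); [|apply continuous_const].
    apply (filter_imp (fun z => x - 1 < z < 0)); [|apply locally_open_interval; lra].
    intros z Hz. unfold pw. destruct (Rlt_dec 0 z); lra.
  - intros Q [e He].
    (* The radius [e^(1/a)] is the point where the increasing function [z^a] reaches [e]. *)
    assert (Hd : 0 < Rpower e (/ a)) by apply exp_pos.
    exists (mkposreal _ Hd). intros z Hz. apply He.
    change (Rabs (z - 0) < Rpower e (/ a)) in Hz. change (Rabs (pw a z - pw a 0) < e).
    unfold pw. destruct (Rlt_dec 0 0); [lra|]. pose proof (cond_pos e).
    destruct (Rlt_dec 0 z) as [Hz0|_]; [|rewrite Rminus_0_r, Rabs_R0; assumption].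
    rewrite Rminus_0_r, Rabs_right in Hz by lra.
    rewrite Rminus_0_r, Rabs_right by (left; apply exp_pos).
    replace (pos e) with (Rpower (Rpower e (/ a)) a).
    + apply Rlt_Rpower_l; lra.
    + rewrite Rpower_mult, Rinv_l, Rpower_1; lra.
  - apply (continuous_ext_loc _ (fun z => Rpower z a)).
    + apply (filter_imp (fun z => 0 < z < x + 1)); [|apply locally_open_interval; lra].
      intros z Hz. unfold pw. destruct (Rlt_dec 0 z); lra.
    + apply @ex_derive_continuous. unfold Rpower. auto_derive. lra.
Qed.

Definition jacobi (al be x : R) : R := pw al x * pw be (1 - x).

Lemma cont_jacobi al be : 0 < al -> 0 < be -> cont (jacobi al be).
Proof.
  intros Ha Hb. apply cont_mult; [now apply cont_pw|].
  apply (cont_comp (pw be) (fun x => 1 - x)); [now apply cont_pw|].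
  apply cont_minus; [apply cont_const|apply cont_id].
Qed.

Lemma jacobi_in al be x : 0 < x < 1 -> jacobi al be x = Rpower x al * Rpower (1 - x) be.
Proof.
  intros Hx. unfold jacobi, pw. destruct (Rlt_dec 0 x); [|lra]. destruct (Rlt_dec 0 (1 - x)); lra.
Qed.

Lemma jacobi_pos al be x : 0 < x < 1 -> 0 < jacobi al be x.
Proof. intros Hx. rewrite jacobi_in by assumption. apply Rmult_lt_0_compat; apply exp_pos. Qed.

Lemma jacobi_at_1 al be : jacobi al be 1 = 0.
Proof. unfold jacobi, pw. destruct (Rlt_dec 0 (1 - 1)); [lra|ring]. Qed.

Lemma is_derive_jacobi al be x : 0 < x < 1 ->
  is_derive (jacobi al be) x ((al / x - be / (1 - x)) * jacobi al be x).
Proof.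
  intros Hx. rewrite jacobi_in by assumption.
  apply (is_derive_ext_loc (fun z => Rpower z al * Rpower (1 - z) be)).
  - apply (filter_imp (fun z => 0 < z < 1)); [|now apply locally_open_interval].
    intros z Hz. now rewrite jacobi_in.
  - unfold Rpower. auto_derive; [lra|]. unfold Rdiv, Rminus. field. lra.
Qed.

Section Weight.

Variables al be A B : R.
Hypotheses (Hal : 0 < al) (Hbe : 0 < be).

Local Notation W := (jacobi al be).

Definition wint (t : R) (f : R -> R) : R :=
  A * RInt (fun x => f x * W x) 0 1 + B * RInt (fun x => f x * W x) t 1.

Let contW : cont W.
Proof. now apply cont_jacobi. Qed.

Let contfW f : cont f -> cont (fun x => f x * W x).
Proof. intros Hf. now apply cont_mult. Qed.

Lemma wint_ext t f g : (forall x, f x = g x) -> wint t f = wint t g.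
Proof.
  intros H. unfold wint.
  rewrite (RInt_ext (fun x => f x * W x) (fun x => g x * W x) 0 1),
    (RInt_ext (fun x => f x * W x) (fun x => g x * W x) t 1); trivial;
    intros x _; now rewrite H.
Qed.

Lemma wint_plus t f g : cont f -> cont g ->
  wint t (fun x => f x + g x) = wint t f + wint t g.
Proof.
  intros Hf Hg. unfold wint.
  assert (E : forall a b, RInt (fun x => (f x + g x) * W x) a b =
    RInt (fun x => f x * W x) a b + RInt (fun x => g x * W x) a b).
  { intros a b. rewrite (RInt_ext _ (fun x => plus (f x * W x) (g x * W x))).
    - apply @RInt_plus; now apply ex_RInt_cont, contfW.
    - intros x _. unfold plus; simpl. ring. }
  rewrite !E. ring.
Qed.

Lemma wint_scal t a f : cont f -> wint t (fun x => a * f x) = a * wint t f.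
Proof.
  intros Hf. unfold wint.
  assert (E : forall u v, RInt (fun x => (a * f x) * W x) u v =
    a * RInt (fun x => f x * W x) u v).
  { intros u v. rewrite (RInt_ext _ (fun x => scal a (f x * W x))).
    - apply @RInt_scal. now apply ex_RInt_cont, contfW.
    - intros x _. unfold scal; simpl. unfold mult; simpl. ring. }
  rewrite !E. ring.
Qed.

Lemma wint_lin2 t a b f g F : cont f -> cont g -> (forall x, F x = a * f x + b * g x) ->
  wint t F = a * wint t f + b * wint t g.
Proof.
  intros Hf Hg E. rewrite (wint_ext t F _ E), wint_plus, !wint_scal; solve_cont. ring.
Qed.

Lemma wint_zero t : wint t (fun _ => 0) = 0.
Proof.
  rewrite (wint_lin2 t 0 0 (fun _ => 0) (fun _ => 0)); solve_cont; [ring|intros; ring].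
Qed.

Lemma wint_sumR t n (f : nat -> R -> R) a : (forall k, cont (f k)) ->
  wint t (fun x => sumR n (fun k => a k * f k x)) = sumR n (fun k => a k * wint t (f k)).
Proof.
  intros Hf. induction n as [|n IH]; simpl; [apply wint_zero|].
  rewrite wint_plus, wint_scal, IH; auto.
  - clear IH. induction n as [|n IH]; simpl; [apply cont_const|].
    apply cont_plus; [assumption|]. apply cont_mult; [apply cont_const|apply Hf].
  - apply cont_mult; [apply cont_const|apply Hf].
Qed.

Lemma is_derive_wint t f : cont f ->
  is_derive (fun s => wint s f) t (- B * f t * W t).
Proof.
  intros Hf. unfold wint.
  eapply is_derive_eq.
  - apply is_derive_Rplus; [apply is_derive_Rconst|].
    apply @is_derive_scal, (is_derive_RInt_lower _ 1 t (contfW f Hf)).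
  - unfold mult; simpl; ring.
Qed.

(** The bridge from the improper integrals of the definitions to [wint]. The comparison is made only
    inside (0,1), where [jacobi] agrees with the [Rpower] product, so the values of [Rpower] at the
    end points do not interfere. *)
Lemma imp_int01_wint t f g : 0 < t < 1 -> cont f ->
  (forall x, 0 < x < 1 -> g x = f x * w al be A B t x) -> imp_int01 g (wint t f).
Proof.
  intros Ht Hf Hg.
  set (K := fun x => RInt (fun x => f x * W x) 0 x).
  apply (imp_int01_ext (fun x => (f x * W x) * (A + B * theta (x - t)))).
  { intros x Hx. rewrite Hg, jacobi_in by assumption. unfold w. ring. }
  replace (wint t f) with (A * (K 1 - K 0) + B * (K 1 - K t)).
  - assert (DK : forall x, is_derive K x (f x * W x)).
    { intros x. apply (is_derive_RInt_upper (fun x => f x * W x)). now apply contfW. }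
    apply imp_int01_step; auto.
    + apply @ex_derive_continuous. eexists; apply DK.
    + apply @ex_derive_continuous. eexists; apply DK.
    + intros x _. now apply contfW.
  - unfold wint, K. rewrite RInt_point.
    pose proof (RInt_Chasles (fun x => f x * W x) 0 t 1 (ex_RInt_cont _ _ _ (contfW f Hf))
      (ex_RInt_cont _ _ _ (contfW f Hf))) as E.
    unfold plus, zero in *; simpl in *. rewrite <- E. ring.
Qed.

Lemma Integral01_wint t f g : 0 < t < 1 -> cont f ->
  (forall x, 0 < x < 1 -> g x = f x * w al be A B t x) -> Integral01 g = wint t f.
Proof. intros. now apply Integral01_eq, imp_int01_wint. Qed.

(* The primitive of [Q W / (1 - x)] comes from differentiating [x Q W]; it is continuous up
   to the end points, which settles convergence and value of the improper integral at once. *)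
Lemma imp_int01_parts t (Q Q' g : R -> R) : 0 < t < 1 -> cont Q' -> (forall x, is_derive Q x (Q' x)) ->
  (forall x, 0 < x < 1 -> g x = Q x / (1 - x) * w al be A B t x) ->
  imp_int01 g ((wint t (fun x => (1 + al + be) * Q x + x * Q' x) + B * t * Q t * W t) / be).
Proof.
  intros Ht HQ' DQ Hg.
  assert (HQ : cont Q). { intros x. apply @ex_derive_continuous. eexists; apply DQ. }
  (* Since [x/(1-x) = 1/(1-x) - 1], the derivative of [x W] is [(1+al+be) W - be W/(1-x)]. Hence
     [be Q W/(1-x)] equals [q] minus the derivative of [x Q W], and [K] below is its primitive
     divided by [be]. *)
  set (q := fun x => ((1 + al + be) * Q x + x * Q' x) * W x).
  assert (Hq : cont q). { unfold q. solve_cont. }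
  set (K := fun x => (RInt q 0 x - x * Q x * W x) / be).
  assert (CK : cont K).
  { apply (cont_ext (fun x => / be * (RInt q 0 x - x * Q x * W x))).
    { intros; unfold K, Rdiv; ring. }
    apply cont_mult; [apply cont_const|]. apply cont_minus; [|solve_cont].
    intros x. apply @ex_derive_continuous. eexists. now apply (is_derive_RInt_upper q). }
  apply (imp_int01_ext (fun x => (Q x / (1 - x) * W x) * (A + B * theta (x - t)))).
  { intros x Hx. rewrite Hg, jacobi_in by assumption. unfold w. ring. }
  replace (_ / be) with (A * (K 1 - K 0) + B * (K 1 - K t)).
  - apply imp_int01_step; [assumption|apply CK|apply CK| |].
    + intros x Hx.
      apply (is_derive_ext (fun x => / be * (RInt q 0 x + (- 1) * (x * (Q x * W x))))).
      { intros z. unfold K, Rdiv. match goal with |- ?a = ?b => change (@eq R a b) end. ring. }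
      eapply is_derive_eq.
      * apply @is_derive_scal, is_derive_Rplus; [now apply (is_derive_RInt_upper q)|].
        apply @is_derive_scal, is_derive_Rmult; [apply @is_derive_id|].
        apply is_derive_Rmult; [apply DQ|now apply is_derive_jacobi].
      * unfold q, one; simpl. field. lra.
    + intros x Hx. apply (continuous_mult (fun x => Q x / (1 - x)) W); [|apply contW].
      apply (continuous_mult Q (fun x => / (1 - x))); [apply HQ|].
      apply @ex_derive_continuous. auto_derive. lra.
  - unfold wint. change (fun x => _ * W x) with q. unfold K. rewrite RInt_point, jacobi_at_1.
    pose proof (RInt_Chasles q 0 t 1 (ex_RInt_cont _ _ _ Hq) (ex_RInt_cont _ _ _ Hq)) as E.
    unfold plus, zero in *; simpl in *. rewrite <- E. field. lra.
Qed.

(** Take [Q = (1-x) q] in [imp_int01_parts]: the singular factor cancels, so the improper integral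
    of [q w] is evaluated in two ways, and uniqueness equates them. Moving the term [be q] to the
    other side produces the constants [1+al] and [2+al+be]. *)
Lemma wint_parts t (q q' : R -> R) : 0 < t < 1 -> cont q' -> (forall x, is_derive q x (q' x)) ->
  wint t (fun x => (1 + al - (2 + al + be) * x) * q x + x * (1 - x) * q' x)
  = - B * t * (1 - t) * W t * q t.
Proof.
  intros Ht Hq' Dq.
  assert (Hq : cont q). { intros x. apply @ex_derive_continuous. eexists; apply Dq. }
  assert (H : wint t q =
    (wint t (fun x => (1 + al + be) * ((1 - x) * q x) + x * (- 1 * q x + (1 - x) * q' x))
     + B * t * ((1 - t) * q t) * W t) / be).
  { apply (imp_int01_unique (fun x => q x * w al be A B t x)).
    - now apply imp_int01_wint.
    - apply (imp_int01_parts t (fun x => (1 - x) * q x)); auto; [solve_cont| |].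
      + intros x. apply (is_derive_Rmult (fun x => 1 - x) q); [|apply Dq].
        auto_derive; [trivial|ring].
      + intros x Hx. field. lra. }
  rewrite (wint_lin2 t 1 (- be)
    (fun x => (1 + al + be) * ((1 - x) * q x) + x * (- 1 * q x + (1 - x) * q' x)) q);
    solve_cont; [|intros; ring].
  rewrite H. field. lra.
Qed.

Hypotheses (HA : 0 <= A) (HAB : 0 <= A + B) (Hnz : ~ (A = 0 /\ B = 0)).

(** A nonzero polynomial cannot vanish on a whole interval, so its square has positive integral over
    both [[0,t]] and [[t,1]]. These carry the weights [A] and [A+B], which are nonnegative and not
    both 0. *)
Lemma wint_sq_pos t N c k : 0 < t < 1 -> (k < N)%nat -> c k <> 0 ->
  0 < wint t (fun x => pv N c x * pv N c x).
Proof.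
  intros Ht Hk Hc.
  set (f := fun x => pv N c x * pv N c x * W x).
  assert (Hf : cont f) by (unfold f; solve_cont).
  assert (Hf0 : forall x, 0 <= f x).
  { intros x. unfold f, jacobi, pw.
    apply Rmult_le_pos; [apply Rle_0_sqr|].
    apply Rmult_le_pos; [destruct (Rlt_dec 0 x)|destruct (Rlt_dec 0 (1 - x))];
      try apply Rle_refl; left; apply exp_pos. }
  assert (Hpos : forall u v, 0 <= u -> u < v -> v <= 1 -> 0 < RInt f u v).
  { intros u v Hu Huv Hv.
    destruct (classic (exists x, u < x < v /\ pv N c x <> 0)) as [[x [Hx Hp]]|Hn].
    - apply (RInt_pos f u v x); auto. unfold f. apply Rmult_lt_0_compat.
      + now apply Rlt_0_sqr.
      + apply jacobi_pos. lra.
    - exfalso. apply Hc. apply (pv_zero_coef N c u v); auto.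
      intros x Hx. destruct (Req_dec (pv N c x) 0) as [|Hp]; [assumption|].
      exfalso. apply Hn. now exists x. }
  pose proof (Hpos 0 t). pose proof (Hpos t 1).
  unfold wint. change (fun x => _) with f.
  pose proof (RInt_Chasles f 0 t 1 (ex_RInt_cont _ _ _ Hf) (ex_RInt_cont _ _ _ Hf)) as E.
  unfold plus in E; simpl in E. rewrite <- E.
  replace (_ + _) with (A * RInt f 0 t + (A + B) * RInt f t 1) by ring.
  destruct HA as [HA'|HA'], HAB as [HAB'|HAB'].
  - apply Rplus_lt_0_compat; apply Rmult_lt_0_compat; lra.
  - rewrite <- HAB', Rmult_0_l, Rplus_0_r. apply Rmult_lt_0_compat; lra.
  - rewrite <- HA', Rmult_0_l, Rplus_0_l. apply Rmult_lt_0_compat; lra.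
  - exfalso. apply Hnz. lra.
Qed.

(** * Families of polynomials depending on a parameter *)

(** A curve of polynomials with derivative [F'] at the single parameter value [t]. The bound [N] is
    common to all [s], which keeps every integral of the family a sum of fixed length. *)
Definition fam (t : R) (F : R -> R -> R) (F' : R -> R) : Prop :=
  exists N (c : R -> nat -> R) (c' : nat -> R),
    (forall s x, F s x = pv N (c s) x) /\ (forall x, F' x = pv N c' x) /\
    (forall k, is_derive (fun s => c s k) t (c' k)).

Lemma fam_ext t F G F' G' : (forall s x, F s x = G s x) -> (forall x, F' x = G' x) ->
  fam t F F' -> fam t G G'.
Proof.
  intros E E' [N [c [c' [H [H' D]]]]]. exists N, c, c'. split; [|split]; trivial.
  - intros; now rewrite <- E.
  - intros; now rewrite <- E'.
Qed.

Lemma fam_pad t F F' N : fam t F F' -> exists M (c : R -> nat -> R) (c' : nat -> R),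
    (N <= M)%nat /\
    (forall s x, F s x = pv M (c s) x) /\ (forall x, F' x = pv M c' x) /\
    (forall k, is_derive (fun s => c s k) t (c' k)).
Proof.
  intros [N' [c [c' [H [H' D]]]]].
  exists (N + N')%nat, (fun s k => if Nat.ltb k N' then c s k else 0),
    (fun k => if Nat.ltb k N' then c' k else 0).
  split; [lia|]. split; [|split].
  - intros. rewrite pv_pad by lia. apply H.
  - intros. rewrite pv_pad by lia. apply H'.
  - intros k. destruct (Nat.ltb k N'); [apply D|apply is_derive_Rconst].
Qed.

Lemma fam_plus t F F' G G' : fam t F F' -> fam t G G' ->
  fam t (fun s x => F s x + G s x) (fun x => F' x + G' x).
Proof.
  intros [N [c [c' [H [H' D]]]]] HG.
  destruct (fam_pad _ _ _ N HG) as [M [d [d' [HNM [K [K' E]]]]]].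
  exists M, (fun s k => (if Nat.ltb k N then c s k else 0) + d s k),
    (fun k => (if Nat.ltb k N then c' k else 0) + d' k).
  split; [|split].
  - intros. rewrite pv_plus, pv_pad by assumption. now rewrite H, K.
  - intros. rewrite pv_plus, pv_pad by assumption. now rewrite H', K'.
  - intros k. apply is_derive_Rplus; [|apply E].
    destruct (Nat.ltb k N); [apply D|apply is_derive_Rconst].
Qed.

Lemma fam_scal t u du F F' : is_derive u t du -> fam t F F' ->
  fam t (fun s x => u s * F s x) (fun x => du * F t x + u t * F' x).
Proof.
  intros Du [N [c [c' [H [H' D]]]]].
  exists N, (fun s k => u s * c s k), (fun k => du * c t k + u t * c' k).
  split; [|split].
  - intros. now rewrite pv_scal, H.
  - intros. now rewrite pv_plus, !pv_scal, H, H'.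
  - intros k. apply (is_derive_Rmult u (fun s => c s k)); auto.
Qed.

Lemma fam_mulX t F F' : fam t F F' -> fam t (fun s x => x * F s x) (fun x => x * F' x).
Proof.
  intros [N [c [c' [H [H' D]]]]].
  exists (S N), (fun s k => match k with O => 0 | S k => c s k end),
    (fun k => match k with O => 0 | S k => c' k end).
  split; [|split].
  - intros. now rewrite pv_shift, H.
  - intros. now rewrite pv_shift, H'.
  - intros [|k]; [apply is_derive_Rconst|apply D].
Qed.

Lemma fam_mulXn t n F F' : fam t F F' -> fam t (fun s x => x ^ n * F s x) (fun x => x ^ n * F' x).
Proof.
  intros H. induction n as [|n IH].
  - apply (fam_ext t F _ F'); trivial; intros; simpl; ring.
  - apply (fam_ext t _ _ _ _ (fun s x => eq_sym (Rmult_assoc x (x ^ n) (F s x)))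
      (fun x => eq_sym (Rmult_assoc x (x ^ n) (F' x)))).
    apply (fam_mulX t _ _ IH).
Qed.

(** Induction on the number of coefficients of the second factor: each step adds one term
    [c s N * x^N * F s x], so convolution of coefficient sequences never appears. *)
Lemma fam_mul t F F' G G' : fam t F F' -> fam t G G' ->
  fam t (fun s x => F s x * G s x) (fun x => F' x * G t x + F t x * G' x).
Proof.
  intros HF [N [c [c' [H [H' D]]]]].
  apply (fam_ext t (fun s x => F s x * pv N (c s) x) _
    (fun x => F' x * pv N (c t) x + F t x * pv N c' x)).
  { intros; now rewrite H. }
  { intros; now rewrite H, H'. }
  clear G G' H H'. induction N as [|N IH].
  - exists 0%nat, (fun _ _ => 0), (fun _ => 0). unfold pv; simpl.
    split; [|split]; [intros; ring..|intros; apply is_derive_Rconst].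
  - pose proof (fam_plus t _ _ _ _ IH (fam_scal t _ _ _ _ (D N) (fam_mulXn t N _ _ HF))) as E.
    revert E. apply fam_ext; intros; unfold pv; simpl; ring.
Qed.

Lemma fam_polyval t n (c : R -> nat -> R) c' :
  (forall k, is_derive (fun s => c s k) t (c' k)) ->
  fam t (fun s => polyval n (c s)) (pv n c').
Proof.
  intros D.
  apply (fam_ext t (fun s x => x ^ n * 1 + pv n (c s) x) _ (fun x => x ^ n * 0 + pv n c' x)).
  { intros; unfold polyval, pv; ring. }
  { intros; ring. }
  apply fam_plus.
  - apply (fam_mulXn t n (fun _ _ => 1) (fun _ => 0)).
    exists 1%nat, (fun _ _ => 1), (fun _ => 0). unfold pv; simpl.
    split; [|split]; [intros; ring..|intros; apply is_derive_Rconst].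
  - exists n, c, c'. split; [|split]; trivial.
Qed.

Lemma wint_pv t N c : wint t (pv N c) = sumR N (fun k => c k * wint t (fun x => x ^ k)).
Proof.
  apply (wint_sumR t N (fun k x => x ^ k) c). intros; solve_cont.
Qed.

(** The Leibniz rule with a moving end point. Expanded in monomials, it is the product rule for
    coefficient times moment; the derivatives of the moments add up to the boundary term. *)
Lemma is_derive_wint_fam t F F' : fam t F F' ->
  is_derive (fun s => wint s (F s)) t (wint t F' - B * W t * F t t).
Proof.
  intros [N [c [c' [H [H' D]]]]].
  apply (is_derive_ext (fun s => sumR N (fun k => c s k * wint s (fun x => x ^ k)))).
  { intros s. rewrite <- wint_pv. apply wint_ext. intros; now rewrite H. }
  eapply is_derive_eq.
  - apply (is_derive_sumR N (fun k s => c s k * wint s (fun x => x ^ k))).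
    intros k _. apply is_derive_Rmult; [apply D|]. apply is_derive_wint, cont_pow.
  - rewrite sumR_plus, <- wint_pv, (wint_ext t F' _ H'), H.
    unfold Rminus. f_equal.
    unfold pv. rewrite Ropp_mult_distr_l, <- sumR_scal. apply sumR_ext. intros; ring.
Qed.

(** * Orthogonal polynomials *)

(** [polyval n c] has an implicit leading 1 and ignores [c k] for [k >= n]; this is its true
    coefficient sequence, which also serves as a row of the triangular matrix in [detn_gram]. *)
Definition full (n : nat) (c : nat -> R) (k : nat) : R :=
  if Nat.ltb k n then c k else if Nat.eqb k n then 1 else 0.

Lemma polyval_full n N c x : (n < N)%nat -> polyval n c x = pv N (full n c) x.
Proof.
  intros H. induction N as [|N IH]; [lia|].
  unfold pv; simpl. destruct (Nat.eq_dec n N) as [->|Hn].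
  - unfold polyval. rewrite (sumR_ext N (fun k => full N c k * x ^ k) (fun k => c k * x ^ k)).
    + unfold full. rewrite Nat.ltb_irrefl, Nat.eqb_refl. ring.
    + intros k Hk. unfold full. now rewrite (proj2 (Nat.ltb_lt k N)) by lia.
  - rewrite IH by lia. unfold full at 3.
    rewrite (proj2 (Nat.ltb_ge N n)), (proj2 (Nat.eqb_neq N n)) by lia. unfold pv. ring.
Qed.

Lemma wint_polyval_sq_pos t n c : 0 < t < 1 ->
  0 < wint t (fun x => polyval n c x * polyval n c x).
Proof.
  intros Ht.
  rewrite (wint_ext t _ (fun x => pv (S n) (full n c) x * pv (S n) (full n c) x)).
  - apply (wint_sq_pos t (S n) _ n); auto.
    unfold full. rewrite Nat.ltb_irrefl, Nat.eqb_refl. lra.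
  - intros x. now rewrite <- polyval_full by lia.
Qed.

Definition orth (t : R) (n : nat) (p : R -> R) : Prop :=
  forall f, deg_lt n f -> wint t (fun x => p x * f x) = 0.

(** Monic polynomials, one of each degree below [n], span everything of degree below [n]:
    subtracting [a] times the monic one of top degree lowers the degree of [f]. *)
Lemma orth_basis t n p (c : nat -> nat -> R) : cont p ->
  (forall j, (j < n)%nat -> wint t (fun x => p x * polyval j (c j) x) = 0) -> orth t n p.
Proof.
  intros Hp. induction n as [|n IH]; intros H f Hf.
  - destruct Hf as [d Hd]. rewrite <- (wint_zero t). apply wint_ext. intros x.
    rewrite Hd. unfold pv; simpl. ring.
  - destruct (deg_lt_S _ _ Hf) as [a [g [Hg E]]].
    assert (Hg' : deg_lt n (fun x => g x + (- a) * pv n (c n) x)).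
    { apply deg_lt_plus; [assumption|]. apply deg_lt_scal, deg_lt_pv. }
    pose proof (cont_deg_lt _ _ Hg).
    rewrite (wint_lin2 t a 1 (fun x => p x * polyval n (c n) x)
      (fun x => p x * (g x + (- a) * pv n (c n) x))); solve_cont.
    + rewrite H, (IH (fun j Hj => H j (Nat.lt_lt_succ_r _ _ Hj)) _ Hg') by lia. ring.
    + intros x. rewrite E. unfold polyval, pv. ring.
Qed.

(** The difference of the two polynomials has degree below [n], so it is orthogonal to both, hence
    to itself, and positivity of the norm excludes a nonzero coefficient. *)
Lemma orth_unique t n c d : 0 < t < 1 -> orth t n (polyval n c) -> orth t n (polyval n d) ->
  forall k, (k < n)%nat -> c k = d k.
Proof.
  intros Ht Hc Hd k Hk. destruct (Req_dec (c k) (d k)) as [|Hn]; [assumption|exfalso].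
  set (e := fun k => c k + (- 1) * d k).
  assert (0 < wint t (fun x => pv n e x * pv n e x)).
  { apply (wint_sq_pos t n e k); auto. unfold e. lra. }
  rewrite (wint_lin2 t 1 (- 1) (fun x => polyval n c x * pv n e x)
    (fun x => polyval n d x * pv n e x)) in H; solve_cont.
  - rewrite (Hc _ (deg_lt_pv n e)), (Hd _ (deg_lt_pv n e)) in H. lra.
  - intros x. unfold e at 1. rewrite pv_plus, pv_scal. unfold polyval, pv. ring.
Qed.

(** Gram-Schmidt needs all lower polynomials at once, hence the form up to [n]. [C] is quantified
    before [s], so that one family serves all parameters and can be differentiated;
    differentiability travels through the induction because the projection coefficients are
    quotients of integrals of lower families. *)
Lemma orth_exists_upto n : exists C : nat -> R -> nat -> R, forall m, (m < n)%nat ->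
  forall s, 0 < s < 1 ->
    orth s m (polyval m (C m s)) /\ forall k, ex_derive (fun u => C m u k) s.
Proof.
  induction n as [|n [C HC]]; [exists (fun _ _ _ => 0); intros; lia|].
  set (nrm := fun j s => wint s (fun x => polyval j (C j s) x * polyval j (C j s) x)).
  set (lam := fun j s => - (wint s (fun x => x ^ n * polyval j (C j s) x) / nrm j s)).
  set (c := fun s k => sumR n (fun j => lam j s * full j (C j s) k)).
  exists (fun m => if Nat.eqb m n then c else C m). intros m Hm s Hs.
  destruct (Nat.eqb_spec m n) as [->|Hmn]; [|apply HC; [lia|assumption]].
  assert (Hnrm : forall j, 0 < nrm j s) by (intros; now apply wint_polyval_sq_pos).
  split.
  - assert (E : forall x, polyval n (c s) x =
      x ^ n + sumR n (fun j => lam j s * polyval j (C j s) x)).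
    { intros x. unfold polyval at 1. f_equal.
      rewrite (sumR_ext n (fun j => lam j s * polyval j (C j s) x)
        (fun j => sumR n (fun k => lam j s * (full j (C j s) k * x ^ k)))).
      - rewrite sumR_swap. apply sumR_ext. intros k _. unfold c.
        rewrite Rmult_comm, <- sumR_scal. apply sumR_ext. intros; ring.
      - intros j Hj. rewrite sumR_scal, (polyval_full j n) by assumption. reflexivity. }
    apply (orth_basis s n _ (fun j => C j s)); [solve_cont|].
    intros i Hi.
    rewrite (wint_ext s _ (fun x => x ^ n * polyval i (C i s) x +
      sumR n (fun j => lam j s * (polyval j (C j s) x * polyval i (C i s) x)))).
    2:{ intros x. rewrite E, Rmult_plus_distr_r. f_equal.
        rewrite Rmult_comm, <- sumR_scal. apply sumR_ext. intros; ring. }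
    rewrite wint_plus, (wint_sumR s n (fun j x => polyval j (C j s) x * polyval i (C i s) x)).
    + rewrite (sumR_single n i); [|assumption|].
      * fold (nrm i s). unfold lam. field. apply Rgt_not_eq, Hnrm.
      * intros j Hj Hji. apply Rmult_eq_0_compat_l.
        destruct (Nat.lt_ge_cases i j) as [Hij|Hij].
        -- apply (proj1 (HC j Hj s Hs)).
           apply (deg_lt_le (S i)); [lia|apply deg_lt_polyval].
        -- rewrite (wint_ext s _ (fun x => polyval i (C i s) x * polyval j (C j s) x))
             by (intros; ring).
           apply (proj1 (HC i Hi s Hs)).
           apply (deg_lt_le (S j)); [lia|apply deg_lt_polyval].
    + intros; solve_cont.
    + solve_cont.
    + apply (cont_ext (fun x => sumR n (fun j => lam j s * polyval j (C j s) x)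
          * polyval i (C i s) x)).
      { intros x. rewrite Rmult_comm, <- sumR_scal. apply sumR_ext. intros; ring. }
      apply cont_mult; [|solve_cont].
      apply (cont_ext (fun x => polyval n (c s) x - x ^ n)); [|solve_cont].
      intros x. rewrite E. ring.
  - assert (DC : forall j, (j < n)%nat ->
      fam s (fun u => polyval j (C j u)) (pv j (fun k => Derive (fun u => C j u k) s))).
    { intros j Hj. apply fam_polyval. intros k. apply Derive_correct. now apply HC. }
    intros k. unfold c.
    (* [Derive] is total, so the witness can be written down before the summands are shown to be
       differentiable. *)
    exists (sumR n (fun j => Derive (fun u => lam j u * full j (C j u) k) s)).
    apply (is_derive_sumR n (fun j u => lam j u * full j (C j u) k)). intros j Hj.
    apply Derive_correct. apply (ex_derive_mult (lam j) (fun u => full j (C j u) k)).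
    + unfold lam. apply (ex_derive_opp (V := R_NormedModule)), ex_derive_div.
      * eexists. apply (is_derive_wint_fam s (fun u x => x ^ n * polyval j (C j u) x)).
        now apply fam_mulXn, DC.
      * eexists. apply (is_derive_wint_fam s
          (fun u x => polyval j (C j u) x * polyval j (C j u) x)).
        now apply fam_mul; apply DC.
      * apply Rgt_not_eq, Hnrm.
    + unfold full. destruct (Nat.ltb k j); [now apply HC|].
      destruct (Nat.eqb k j); apply ex_derive_const.
Qed.

Lemma orth_exists n : exists c : R -> nat -> R, forall s, 0 < s < 1 ->
  orth s n (polyval n (c s)) /\ forall k, ex_derive (fun u => c u k) s.
Proof.
  destruct (orth_exists_upto (S n)) as [C HC]. exists (C n). apply HC. lia.
Qed.

Lemma is_OPS_exists t : 0 < t < 1 -> exists cf, is_OPS al be A B t cf.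
Proof.
  intros Ht.
  set (cf := fun i => epsilon (inhabits (fun _ => 0)) (fun c => orth t i (polyval i c))).
  assert (Hcf : forall i, orth t i (polyval i (cf i))).
  { intros i. unfold cf. apply epsilon_spec. destruct (orth_exists i) as [c Hc].
    exists (c t). now apply Hc. }
  exists cf. split.
  - intros i j Hij.
    rewrite (Integral01_wint t (fun x => polyval i (cf i) x * polyval j (cf j) x));
      trivial; [|solve_cont].
    destruct (Nat.lt_ge_cases i j) as [H|H].
    + rewrite (wint_ext t _ (fun x => polyval j (cf j) x * polyval i (cf i) x))
        by (intros; ring).
      apply Hcf, (deg_lt_le (S i)); [lia|apply deg_lt_polyval].
    + apply Hcf, (deg_lt_le (S j)); [lia|apply deg_lt_polyval].
  - intros i.
    rewrite (Integral01_wint t (fun x => polyval i (cf i) x * polyval i (cf i) x));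
      trivial; [|solve_cont].
    now apply wint_polyval_sq_pos.
Qed.

(** * The chosen orthogonal polynomials and their dependence on [t] *)

Local Notation P := (P al be A B).
Local Notation OPc := (OPc al be A B).

Lemma P_orth t n : 0 < t < 1 -> orth t n (P n t).
Proof.
  intros Ht.
  assert (H : is_OPS al be A B t (OPc t)).
  { unfold Defs.OPc. apply epsilon_spec. now apply is_OPS_exists. }
  destruct H as [H _]. apply (orth_basis t n _ (OPc t)); [unfold Defs.P; solve_cont|].
  intros j Hj. rewrite <- (H n j) by lia. symmetry.
  apply Integral01_wint; trivial. unfold Defs.P. solve_cont.
Qed.

(** By [orth_unique], the pointwise choice coincides with the Gram-Schmidt family at every parameter
    near [t], and so inherits its derivative. *)
Lemma ex_derive_OPc t n k : 0 < t < 1 -> (k < n)%nat -> ex_derive (fun s => OPc s n k) t.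
Proof.
  intros Ht Hk. destruct (orth_exists n) as [c Hc].
  apply (ex_derive_ext_loc (fun s => c s k)); [|now apply Hc].
  apply (filter_imp (fun s => 0 < s < 1)); [|now apply locally_open_interval].
  intros s Hs. apply (orth_unique s n); trivial; [now apply Hc|now apply P_orth].
Qed.

Definition dOPc (n : nat) (t : R) (k : nat) : R := Derive (fun s => OPc s n k) t.

Lemma fam_P t n : 0 < t < 1 -> fam t (P n) (pv n (dOPc n t)).
Proof.
  intros Ht.
  (* [fam_polyval] asks for differentiability at every index, while the choice is controlled only
     below [n]; the remaining entries are cut to 0. *)
  apply (fam_ext t (fun s => polyval n (fun k => if Nat.ltb k n then OPc s n k else 0)) _
    (pv n (fun k => if Nat.ltb k n then dOPc n t k else 0))).
  - intros s x. unfold Defs.P, polyval. f_equal. apply sumR_ext. intros k Hk.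
    now rewrite (proj2 (Nat.ltb_lt k n)).
  - intros x. now apply pv_pad.
  - apply fam_polyval. intros k. destruct (Nat.ltb_spec k n).
    + now apply Derive_correct, ex_derive_OPc.
    + apply is_derive_Rconst.
Qed.

Lemma cont_P n t : cont (P n t).
Proof. unfold Defs.P. solve_cont. Qed.

Lemma deg_lt_P n t : deg_lt (S n) (P n t).
Proof. apply deg_lt_polyval. Qed.

Lemma h_wint n t : 0 < t < 1 -> h al be A B n t = wint t (fun x => P n t x * P n t x).
Proof.
  intros Ht. apply Integral01_wint; trivial. apply cont_mult; apply cont_P.
Qed.

Lemma h_pos n t : 0 < t < 1 -> 0 < h al be A B n t.
Proof. intros Ht. rewrite h_wint by assumption. now apply wint_polyval_sq_pos. Qed.

(** [f] differs from [a P_n] by a polynomial of degree below [n], which [P_n] annihilates. *)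
Lemma wint_P_lead t n f a e : 0 < t < 1 -> deg_lt n e -> (forall x, f x = a * x ^ n + e x) ->
  wint t (fun x => P n t x * f x) = a * h al be A B n t.
Proof.
  intros Ht He Hf. rewrite h_wint by assumption.
  assert (He' : deg_lt n (fun x => e x + (- a) * pv n (OPc t n) x)).
  { apply deg_lt_plus; [assumption|]. apply deg_lt_scal, deg_lt_pv. }
  pose proof (cont_deg_lt _ _ He'). pose proof (cont_P n t).
  rewrite (wint_lin2 t a 1 (fun x => P n t x * P n t x)
    (fun x => P n t x * (e x + (- a) * pv n (OPc t n) x))).
  - rewrite (P_orth t n Ht _ He'). ring.
  - now apply cont_mult.
  - now apply cont_mult.
  - intros x. rewrite Hf. unfold Defs.P, polyval, pv. ring.
Qed.

Lemma is_derive_h n t : 0 < t < 1 ->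
  is_derive (h al be A B n) t (- B * W t * (P n t t * P n t t)).
Proof.
  intros Ht.
  apply (is_derive_ext_loc (fun s => wint s (fun x => P n s x * P n s x))).
  { apply (filter_imp (fun s => 0 < s < 1)); [|now apply locally_open_interval].
    intros s Hs. now rewrite h_wint. }
  eapply is_derive_eq.
  - apply (is_derive_wint_fam t (fun s x => P n s x * P n s x)).
    apply fam_mul; now apply fam_P.
  - pose proof (cont_P n t).
    rewrite (wint_lin2 t 1 1 (fun x => P n t x * pv n (dOPc n t) x)
      (fun x => P n t x * pv n (dOPc n t) x)); solve_cont; [|intros; ring].
    rewrite (P_orth t n Ht _ (deg_lt_pv _ _)). ring.
Qed.

Lemma is_derive_p1 n t : 0 < t < 1 ->
  is_derive (p1 al be A B (S n)) t (r al be A B (S n) t).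
Proof.
  intros Ht.
  assert (D : is_derive (fun s => OPc s (S n) n) t (dOPc (S n) t n)).
  { apply Derive_correct, ex_derive_OPc; [assumption|lia]. }
  apply (is_derive_eq _ _ _ _ D).
  assert (H0 : is_derive (fun s => wint s (fun x => P (S n) s x * P n s x)) t 0).
  { apply (is_derive_ext_loc (fun _ => 0)); [|apply is_derive_Rconst].
    apply (filter_imp (fun s => 0 < s < 1)); [|now apply locally_open_interval].
    intros s Hs. symmetry. apply P_orth; [assumption|apply deg_lt_P]. }
  pose proof (is_derive_wint_fam t _ _ (fam_mul t _ _ _ _ (fam_P t (S n) Ht) (fam_P t n Ht))) as H1.
  apply (is_derive_uniq _ _ _ _ H0) in H1. cbv beta in H1.
  pose proof (cont_P n t). pose proof (cont_P (S n) t).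
  rewrite (wint_lin2 t 1 1 (fun x => P n t x * pv (S n) (dOPc (S n) t) x)
      (fun x => P (S n) t x * pv n (dOPc n t) x)) in H1; solve_cont; [|intros; ring].
  (* The [t]-derivative of [P (S n)] has degree at most [n], with coefficient of [x^n] equal to the
     derivative of [p1]; pairing it with [P n] isolates that coefficient times [h n]. *)
  rewrite (wint_P_lead t n _ (dOPc (S n) t n) (pv n (dOPc (S n) t)) Ht (deg_lt_pv _ _)) in H1
    by (intros; unfold pv; simpl; ring).
  rewrite (P_orth t (S n) Ht (pv n (dOPc n t))) in H1
    by (apply (deg_lt_le n); [lia|apply deg_lt_pv]).
  unfold r. replace (S n - 1)%nat with n by lia.
  pose proof (h_pos n t Ht). rewrite jacobi_in in H1 by assumption.
  apply (Rmult_eq_reg_r (h al be A B n t)); [|lra].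
  unfold Rdiv. rewrite Rmult_assoc, Rinv_l by lra. lra.
Qed.

(* The subleading coefficient of [P n]; unlike [p1], it vanishes at [n = 0]. *)
Definition sub_lead (n : nat) (t : R) : R :=
  match n with O => 0 | S m => OPc t n m end.

(** The three-term recurrence with its last term absorbed into [e]; the difference of the two
    subleading coefficients is the diagonal recurrence coefficient. *)
Lemma mulX_P n t : exists e, deg_lt n e /\
  forall x, x * P n t x = P (S n) t x + (sub_lead n t - sub_lead (S n) t) * x ^ n + e x.
Proof.
  assert (H : exists e, deg_lt n e /\ forall x, x * P n t x = x ^ S n + sub_lead n t * x ^ n + e x).
  { destruct n as [|n]; unfold sub_lead.
    - exists (fun _ => 0). split; [apply deg_lt_zero|].
      intros x. unfold Defs.P, polyval; simpl. ring.
    - exists (fun x => x * pv n (OPc t (S n)) x). split; [apply deg_lt_mulX, deg_lt_pv|].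
      intros x. unfold Defs.P, polyval, pv; simpl. ring. }
  destruct H as [e [He E]].
  exists (fun x => e x + (- 1) * pv n (OPc t (S n)) x). split.
  - apply deg_lt_plus; [assumption|]. apply deg_lt_scal, deg_lt_pv.
  - intros x. rewrite E. unfold Defs.P, polyval, pv, sub_lead; simpl. ring.
Qed.

Lemma wint_X_P_sq n t : 0 < t < 1 -> wint t (fun x => P n t x * (x * P n t x)) =
  (sub_lead n t - sub_lead (S n) t) * h al be A B n t.
Proof.
  intros Ht. destruct (mulX_P n t) as [e [He E]].
  pose proof (cont_P n t). pose proof (cont_P (S n) t). pose proof (cont_deg_lt _ _ He).
  rewrite (wint_lin2 t 1 1 (fun x => P (S n) t x * P n t x)
    (fun x => P n t x * ((sub_lead n t - sub_lead (S n) t) * x ^ n + e x))); solve_cont.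
  - rewrite (P_orth t (S n) Ht _ (deg_lt_P n t)), (wint_P_lead t n _ _ _ Ht He (fun x => eq_refl)).
    ring.
  - intros x. rewrite E. ring.
Qed.

(** * Identities from integration by parts in [x] *)

Definition dP (n : nat) (t x : R) : R := INR n * x ^ Nat.pred n + dpv n (OPc t n) x.

(** This is [n P_n - x P_n']: the Euler operator multiplies [x^k] by [k], so the leading term
    cancels and the degree drops below [n]. *)
Definition euler_defect (n : nat) (t : R) : R -> R :=
  pv n (fun k => (INR n - INR k) * OPc t n k).

Lemma is_derive_P n t x : is_derive (P n t) x (dP n t x).
Proof.
  apply is_derive_Rplus; [|apply is_derive_pv].
  eapply is_derive_eq; [apply (is_derive_pow (fun x => x)), @is_derive_id|].
  unfold one; simpl. ring.
Qed.

Lemma mulX_dP n t x : x * dP n t x = INR n * P n t x - euler_defect n t x.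
Proof.
  unfold dP. rewrite Rmult_plus_distr_l, mul_dpv.
  replace (x * (INR n * x ^ Nat.pred n)) with (INR n * x ^ n) by (destruct n; simpl; ring).
  assert (E : pv n (fun k => INR k * OPc t n k) x + euler_defect n t x
    = INR n * sumR n (fun k => OPc t n k * x ^ k)).
  { unfold euler_defect, pv. rewrite <- sumR_plus, <- sumR_scal. apply sumR_ext. intros; ring. }
  unfold Defs.P, polyval. lra.
Qed.

Lemma cont_dP n t : cont (dP n t).
Proof.
  unfold dP. solve_cont.
Qed.

(** Put [q = P_n^2] in [wint_parts] and replace [x P_n'] by [n P_n - g], with [g] the Euler defect.
    What remains is a combination of [P_n^2], [x P_n^2] and [(1-x) P_n g]; there [P_n g] integrates
    to 0, while [x g] again has degree [n] and contributes its leading coefficient. *)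
Lemma P_sq_identity n t : 0 < t < 1 ->
  - B * t * (1 - t) * W t * (P n t t * P n t t) =
  h al be A B n t * ((1 + al + 2 * INR n)
    - (2 + al + be + 2 * INR n) * (sub_lead n t - sub_lead (S n) t) + 2 * sub_lead n t).
Proof.
  intros Ht.
  pose proof (cont_P n t). pose proof (cont_dP n t).
  rewrite <- (wint_parts t (fun x => P n t x * P n t x)
    (fun x => dP n t x * P n t x + P n t x * dP n t x)); trivial; solve_cont.
  2:{ intros x. apply (is_derive_Rmult (P n t) (P n t)); apply is_derive_P. }
  set (g := euler_defect n t).
  assert (Hg : deg_lt n g) by apply deg_lt_pv. pose proof (cont_deg_lt _ _ Hg).
  assert (Hxg : exists e, deg_lt n e /\ forall x, x * g x = sub_lead n t * x ^ n + e x).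
  { destruct n as [|n]; unfold g, euler_defect, sub_lead.
    - exists (fun _ => 0). split; [apply deg_lt_zero|]. intros; unfold pv; simpl; ring.
    (* The top coefficient of [g] carries the factor [INR (S n) - INR n = 1], so it is the
       subleading coefficient itself; the lower ones form the remainder. *)
    - eexists. split; [apply deg_lt_mulX, deg_lt_pv|].
      intros x. instantiate (1 := fun k => (INR (S n) - INR k) * OPc t (S n) k).
      unfold pv. cbn [sumR pow]. rewrite S_INR. ring. }
  destruct Hxg as [e [He Exg]].
  set (p := P n t) in *.
  rewrite (wint_lin2 t (1 + al + 2 * INR n) 1 (fun x => p x * p x)
    (fun x => (- (2 + al + be + 2 * INR n)) * (p x * (x * p x)) +
       2 * (p x * (x * g x) + (- 1) * (p x * g x)))); solve_cont.
  2:{ intros x.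
      replace (x * (1 - x) * (dP n t x * p x + p x * dP n t x))
        with ((1 - x) * 2 * p x * (x * dP n t x)) by ring.
      rewrite mulX_dP. fold p g. ring. }
  rewrite (wint_lin2 t (- (2 + al + be + 2 * INR n)) 2 (fun x => p x * (x * p x))
    (fun x => p x * (x * g x) + (- 1) * (p x * g x))
    (fun x => (- (2 + al + be + 2 * INR n)) * (p x * (x * p x)) +
       2 * (p x * (x * g x) + (- 1) * (p x * g x)))); solve_cont; trivial.
  rewrite (wint_lin2 t 1 (- 1) (fun x => p x * (x * g x)) (fun x => p x * g x)
    (fun x => p x * (x * g x) + (- 1) * (p x * g x))); solve_cont; [|intros; ring].
  unfold p. rewrite (P_orth t n Ht g Hg), (wint_P_lead t n _ _ _ Ht He Exg), wint_X_P_sq, <- h_wint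
    by assumption.
  ring.
Qed.

(** [imp_int01_parts] with [Q = P_(n+1) P_n] cancels the factor [be] of [y], and its boundary term
    divided by [h n] is [t r]. In the integral, [P_(n+1)] annihilates both [P_n] and [x P_n']; only
    the Euler defect of [P_(n+1)] survives against [P_n], giving the subleading coefficient times
    [- h n]. *)
Lemma y_identity n t : 0 < t < 1 ->
  y al be A B (S n) t - t * r al be A B (S n) t = - OPc t (S n) n.
Proof.
  intros Ht. unfold y, r. replace (S n - 1)%nat with n by lia.
  pose proof (h_pos n t Ht) as Hh.
  pose proof (cont_P n t). pose proof (cont_dP n t).
  pose proof (cont_P (S n) t). pose proof (cont_dP (S n) t).
  rewrite (Integral01_eq _ _ (imp_int01_parts t (fun x => P (S n) t x * P n t x)
    (fun x => dP (S n) t x * P n t x + P (S n) t x * dP n t x) _ Ht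
    ltac:(solve_cont)
    (fun x => is_derive_Rmult _ _ x _ _ (is_derive_P (S n) t x) (is_derive_P n t x))
    (fun x Hx => eq_refl))).
  set (g := euler_defect (S n) t).
  assert (Hg : deg_lt (S n) g) by apply deg_lt_pv. pose proof (cont_deg_lt _ _ Hg).
  assert (Eg : forall x, g x = OPc t (S n) n * x ^ n
    + pv n (fun k => (INR (S n) - INR k) * OPc t (S n) k) x).
  { intros x. unfold g, euler_defect, pv. cbn [sumR]. rewrite S_INR. ring. }
  assert (Hd : deg_lt (S n) (fun x => x * dP n t x)).
  { apply (deg_lt_ext _ (fun x => INR n * P n t x + (- 1) * euler_defect n t x)).
    - intros x. rewrite mulX_dP. ring.
    - apply deg_lt_plus; apply deg_lt_scal; [apply deg_lt_P|].
      apply (deg_lt_le n); [lia|apply deg_lt_pv]. }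
  rewrite (wint_lin2 t (1 + al + be + INR (S n)) 1 (fun x => P (S n) t x * P n t x)
    (fun x => P (S n) t x * (x * dP n t x) + (- 1) * (P n t x * g x))); solve_cont.
  2:{ intros x. replace (x * (dP (S n) t x * P n t x + P (S n) t x * dP n t x))
        with ((x * dP (S n) t x) * P n t x + P (S n) t x * (x * dP n t x)) by ring.
      rewrite (mulX_dP (S n)). fold g. ring. }
  rewrite (wint_lin2 t 1 (- 1) (fun x => P (S n) t x * (x * dP n t x)) (fun x => P n t x * g x)
    (fun x => P (S n) t x * (x * dP n t x) + (- 1) * (P n t x * g x))); solve_cont; [|intros; ring].
  rewrite (P_orth t (S n) Ht _ (deg_lt_P n t)), (P_orth t (S n) Ht _ Hd),
    (wint_P_lead t n _ _ _ Ht (deg_lt_pv _ _) Eg), jacobi_in by assumption.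
  field. split; lra.
Qed.

(** * The Hankel determinant and its logarithmic derivative *)

Lemma Dn_prod n t : 0 < t < 1 -> Dn al be A B n t = prodR n (fun k => h al be A B k t).
Proof.
  intros Ht. unfold Dn.
  (* With the coefficient rows of the [P i] as [C], the double sum over moments is the integral of
     [P i * P j], expanded in both factors. *)
  apply (Determinant.detn_gram n _ (fun i => full i (OPc t i))).
  - intros i. unfold full. now rewrite Nat.ltb_irrefl, Nat.eqb_refl.
  - intros i j Hij. unfold full.
    now rewrite (proj2 (Nat.ltb_ge j i)), (proj2 (Nat.eqb_neq j i)) by lia.
  - intros i j Hi Hj.
    transitivity (wint t (fun x => P i t x * P j t x)).
    + rewrite (wint_ext t _ (fun x => sumR n (fun k => full i (OPc t i) k *
        (x ^ k * P j t x)))).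
      2:{ intros x. unfold Defs.P at 1. rewrite (polyval_full i n) by assumption.
          unfold pv. rewrite Rmult_comm, <- sumR_scal. apply sumR_ext. intros; ring. }
      rewrite (wint_sumR t n (fun k x => x ^ k * P j t x))
        by (intros; apply cont_mult; [apply cont_pow|apply cont_P]).
      apply sumR_ext. intros k _.
      rewrite (wint_ext t _ (fun x => sumR n (fun l => full j (OPc t j) l * x ^ (k + l)))).
      2:{ intros x. unfold Defs.P at 1. rewrite (polyval_full j n) by assumption.
          unfold pv. rewrite <- sumR_scal. apply sumR_ext. intros. rewrite pow_add. ring. }
      rewrite (wint_sumR t n (fun l x => x ^ (k + l))), <- sumR_scal
        by (intros; apply cont_pow).
      apply sumR_ext. intros l _.
      unfold mu. rewrite (Integral01_wint t (fun x => x ^ (k + l))); trivial; [ring|].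
      apply cont_pow.
    + destruct (Nat.eqb_spec i j) as [->|Hij]; [now rewrite h_wint|].
      destruct (Nat.lt_ge_cases i j).
      * rewrite (wint_ext t _ (fun x => P j t x * P i t x)) by (intros; ring).
        apply P_orth; [assumption|]. apply (deg_lt_le (S i)); [lia|apply deg_lt_P].
      * apply P_orth; [assumption|]. apply (deg_lt_le (S j)); [lia|apply deg_lt_P].
Qed.

Lemma prod_h_pos n t : 0 < t < 1 -> 0 < prodR n (fun k => h al be A B k t).
Proof.
  intros Ht. induction n as [|n IH]; simpl; [lra|].
  apply Rmult_lt_0_compat; [assumption|now apply h_pos].
Qed.

(** The closed form lets the induction do the telescoping. By [P_sq_identity], passing from [n] to
    [n+1] adds [(2n+al+be) s_n - (2n+2+al+be) s_(n+1) - (2n+1+al)] to the numerator, [s] being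
    [sub_lead]; the constants are consecutive differences of [n (n+al)]. *)
Lemma is_derive_ln_Dn n t : 0 < t < 1 ->
  is_derive (fun s => ln (Dn al be A B n s)) t
    ((- (2 * INR n + al + be) * sub_lead n t - INR n * (INR n + al)) / (t * (t - 1))).
Proof.
  intros Ht.
  apply (is_derive_ext_loc (fun s => ln (prodR n (fun k => h al be A B k s)))).
  { apply (filter_imp (fun s => 0 < s < 1)); [|now apply locally_open_interval].
    intros s Hs. now rewrite Dn_prod. }
  induction n as [|n IH].
  (* The empty product is 1 and [sub_lead 0 t] is 0, so both sides vanish. *)
  - simpl. eapply is_derive_eq; [apply is_derive_Rconst|]. field. lra.
  - apply (is_derive_ext_loc (fun s => ln (prodR n (fun k => h al be A B k s))
      + ln (h al be A B n s))).
    { apply (filter_imp (fun s => 0 < s < 1)); [|now apply locally_open_interval].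
      intros s Hs. simpl. rewrite ln_mult; [reflexivity|now apply prod_h_pos|now apply h_pos]. }
    pose proof (h_pos n t Ht) as Hh.
    eapply is_derive_eq.
    + apply is_derive_Rplus; [exact IH|].
      apply (is_derive_comp ln (h al be A B n)); [|now apply is_derive_h].
      apply is_derive_ln, Hh.
    + unfold scal; simpl; unfold mult; simpl.
      replace (- B * W t * (P n t t * P n t t)) with
        (h al be A B n t * ((1 + al + 2 * INR n)
          - (2 + al + be + 2 * INR n) * (sub_lead n t - sub_lead (S n) t) + 2 * sub_lead n t)
          / (t * (1 - t))).
      * change (match n with O => 1 | S _ => INR n + 1 end) with (INR (S n)). rewrite S_INR.
        change (OPc t (S n) n) with (sub_lead (S n) t). field. lra.
      * rewrite <- P_sq_identity by assumption. field. lra.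
Qed.

Lemma Hn_sub_lead n t : 0 < t < 1 ->
  Hn al be A B n t = - (2 * INR n + al + be) * sub_lead n t - INR n * (INR n + al).
Proof.
  intros Ht. unfold Hn.
  pose proof (is_derive_ln_Dn n t Ht) as D.
  assert (E : derivable_pt_lim (fun s => ln (Dn al be A B n s)) t
    (epsilon (inhabits 0) (fun l => derivable_pt_lim (fun s => ln (Dn al be A B n s)) t l))).
  { apply (epsilon_spec (inhabits 0)
      (fun l => derivable_pt_lim (fun s => ln (Dn al be A B n s)) t l)). eexists. apply is_derive_Reals, D. }
  apply is_derive_Reals in E.
  rewrite (is_derive_uniq _ _ _ _ E D). field. lra.
Qed.

End Weight.

Theorem theorem3p4 (al be A B : R) (Hal : 0 < al) (Hbe : 0 < be)
  (HA : 0 <= A) (HAB : 0 <= A + B) (Hnz : ~ (A = 0 /\ B = 0))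
  (n : nat) (Hn1 : (1 <= n)%nat) (t : R) (Ht : 0 < t < 1) :
  (exists l, derivable_pt_lim (fun s => ln (Dn al be A B n s)) t l) /\
  Hn al be A B n t
    = (2 * INR n + al + be) * (y al be A B n t - t * r al be A B n t)
      - INR n * (INR n + al) /\
  Hn al be A B n t
    = - (2 * INR n + al + be) * p1 al be A B n t - INR n * (INR n + al) /\
  (exists H', derivable_pt_lim (Hn al be A B n) t H' /\
     r al be A B n t = - H' / (2 * INR n + al + be) /\
     y al be A B n t
       = (- t * H' + Hn al be A B n t + INR n * (INR n + al)) / (2 * INR n + al + be)).
Proof.
  destruct n as [|n]; [lia|]. clear Hn1.
  (* The formula is kept for all [s] in (0,1), not just at [t], because [Hn] is differentiated
     below. *)
  assert (HH : forall s, 0 < s < 1 -> Hn al be A B (S n) s =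
    - (2 * INR (S n) + al + be) * p1 al be A B (S n) s - INR (S n) * (INR (S n) + al)).
  { intros s Hs. now apply Hn_sub_lead. }
  assert (Hy : y al be A B (S n) t - t * r al be A B (S n) t = - p1 al be A B (S n) t)
    by now apply y_identity.
  pose proof (pos_INR (S n)).
  split; [|split; [|split]].
  - eexists. apply is_derive_Reals. now apply is_derive_ln_Dn.
  - rewrite HH, Hy by assumption. ring.
  - now apply HH.
  (* Read off from [HH]: the derivative of [p1] is [r], and the other term is constant in [t]. *)
  - exists (- (2 * INR (S n) + al + be) * r al be A B (S n) t). split; [|split].
    + apply is_derive_Reals.
      apply (is_derive_ext_loc (fun s => - (2 * INR (S n) + al + be) * p1 al be A B (S n) s
        + - (INR (S n) * (INR (S n) + al)))).
      { apply (filter_imp (fun s => 0 < s < 1)); [|now apply locally_open_interval].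
        intros s Hs. now rewrite HH. }
      eapply is_derive_eq.
      * apply is_derive_Rplus; [|apply is_derive_Rconst].
        apply @is_derive_scal. now apply is_derive_p1.
      * unfold mult; simpl; ring.
    + field. lra.
    + rewrite HH by assumption.
      replace (p1 al be A B (S n) t) with
        (t * r al be A B (S n) t - y al be A B (S n) t) by lra.
      field. lra.
Qed.
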